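(* Let $n\ge0$ be an integer. There is a surjective map $$\mathrm{SL}_2(\mathbb{Z})\backslash\{\text{simple closed clockwise paths in } \mathscr{F} \text{ of length } n+3\}\longrightarrow\{\text{Y-friezes of width } n\}$$ determined by $$B_{i,j}=\left[\frac{a_i}{b_i},\frac{a_{i+1}}{b_{i+1}},\frac{a_j}{b_j},\frac{a_{j+1}}{b_{j+1}}\right],\qquad 1\le i-j\le n+2,$$ where $(a_i/b_i)_{i\in\mathbb{Z}}$ is a simple closed clockwise path in $\mathscr{F}$ of length $n+3$ (extended to a biinfinite path) satisfying $a_{i-1}b_i-b_{i-1}a_i=1$ for $i\in\mathbb{Z}$, and $B_{i,j}$ is the $(i,j)$th entry of the Y-frieze $B$ to which the class of the path is sent.
   Context: The Farey graph $\mathscr{F}$ has vertices the reduced rationals $a/b$ together with $\infty=1/0$ (where $a/b$ and $(-a)/(-b)$ represent the same vertex), with an edge between $a/b$ and $c/d$ exactly when $ad-bc=\pm1$. A simple closed clockwise path of length $N=n+3$ in $\mathscr{F}$ is a sequence $a_0/b_0,a_1/b_1,\dots,a_N/b_N$ of vertices, consecutive ones being adjacent in $\mathscr{F}$, with $a_N/b_N=a_0/b_0$ and $a_0/b_0,\dots,a_{N-1}/b_{N-1}$ distinct, which goes clockwise around the extended real line $\mathbb{R}\cup\{\infty\}$ and completes exactly one cycle. The clockwise order is inherited from the unit circle by stereographic projection, with the clockwise direction being that in which real numbers decrease (for example $1/0,\,1/1,\,0/1,\,1/0$ is such a path of length 3). The signs of numerators and denominators are chosen so that $a_{i-1}b_i-b_{i-1}a_i=1$,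 in which case $(a_N,b_N)=-(a_0,b_0)$, and the path is extended to a biinfinite path by $(a_{i+N},b_{i+N})=-(a_i,b_i)$ for $i\in\mathbb{Z}$. The group $\mathrm{SL}_2(\mathbb{Z})$ acts on paths by left multiplication on the column vectors $\begin{pmatrix} a_i \\ b_i \end{pmatrix}$. The cross-ratio of four points on the extended real line is $$[p,q,r,s]=\frac{p-s}{p-q}\cdot\frac{q-r}{r-s},$$ with the usual conventions when one of the points is $\infty$; for the points above, $B_{i,j}=(a_ib_{j+1}-a_{j+1}b_i)(a_{i+1}b_j-a_jb_{i+1})$. A Y-frieze of width $n$ is a map $B\colon\{(i,j)\in\mathbb{Z}\times\mathbb{Z}:1\le i-j\le n+2\}\to\mathbb{Z}$ with $B_{i+1,i}=B_{i+n+2,i}=0$ for all $i\in\mathbb{Z}$, $B_{i,j}>0$ for $2\le i-j\le n+1$, and $(B_{i,j+1}+1)(B_{i+1,j}+1)=B_{i,j}B_{i+1,j+1}$ for $2\le i-j\le n+1$. *)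

(* Defs.v *)
From mathcomp Require Import all_boot all_order all_algebra.
From mathcomp Require Import boolp ring zify.

Set Implicit Arguments.
Unset Strict Implicit.
Unset Printing Implicit Defensive.

Import Order.TTheory GRing.Theory Num.Theory.
Local Open Scope ring_scope.
Local Open Scope quotient_scope.

(* Elements of [option F] are the points of the projective line over [F], with
   [None] standing for infinity. A vertex [Some x] of the Farey graph is the
   reduced fraction [numq x / denq x], and [None] is [1/0]. *)
Definition vertex := option rat.

Definition num (v : vertex) : int := if v is Some x then numq x else 1.
Definition den (v : vertex) : int := if v is Some x then denq x else 0.

Definition fraction (a b : int) : vertex :=
  if b == 0 then None else Some (a%:~R / b%:~R).

Definition farey_edge (v w : vertex) : bool :=
  let d := num v * den w - den v * num w in (d == 1) || (d == -1).

(* The clockwise cyclic order on the extended line is the direction of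
   decrease on the finite points. Cutting the circle at infinity, and taking
   infinity as the first point met, it is the cyclic order induced by the
   linear order [before]. *)
Definition before (v w : vertex) : bool :=
  match v, w with
  | None, Some _ => true
  | Some x, Some y => y < x
  | _, None => false
  end.

Definition clockwise (u v w : vertex) : bool :=
  [|| before u v && before v w, before v w && before w u
    | before w u && before u v].

(* The condition on triples says that the path moves clockwise and that it
   turns around the circle exactly once before returning to its start. *)
Definition is_sc_clockwise_path (N : nat) (p : N.+1.-tuple vertex) : bool :=
  [&& [forall i : 'I_N, farey_edge (nth None p i) (nth None p i.+1)],
      nth None p N == nth None p 0,
      uniq (take N p)
    & [forall i : 'I_N, forall j : 'I_N, forall k : 'I_N,
        (i < j < k)%N ==>
          clockwise (nth None p i) (nth None p j) (nth None p k)]].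

Definition cpath (N : nat) : Type :=
  {p : N.+1.-tuple vertex | is_sc_clockwise_path p}.

Definition pvertex (N : nat) (p : cpath N) (i : nat) : vertex :=
  nth None (val p) i.

(* [a] and [b] are the numerators and denominators of [p], with signs chosen
   so that the determinants are 1, extended to a biinfinite path. Such a lift
   always exists, see [biinfinite_lift_exists]. *)
Definition biinfinite_lift (N : nat) (p : cpath N) (a b : int -> int) : Prop :=
  [/\ forall i : nat, (i <= N)%N -> fraction (a i) (b i) = pvertex p i,
      forall i : int, a (i - 1) * b i - b (i - 1) * a i = 1
    & forall i : int, a (i + N%:Z) = - a i /\ b (i + N%:Z) = - b i].

Definition colv (v : vertex) : 'cV[int]_2 :=
  \col_i (if i == 0 then num v else den v).

Definition vertex_of_col (c : 'cV[int]_2) : vertex := fraction (c 0 0) (c 1 0).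

Definition mobius (M : 'M[int]_2) (v : vertex) : vertex :=
  vertex_of_col (M *m colv v).

Definition sl2_equiv (N : nat) (p q : cpath N) : bool :=
  `[< exists2 M : 'M[int]_2, \det M = 1 &
        forall i : nat, (i <= N)%N -> pvertex q i = mobius M (pvertex p i) >].

Lemma num_den_neq0 v : (num v != 0) || (den v != 0).
Proof. by case: v => [x|] //=; rewrite denq_neq0 orbT. Qed.

Lemma fraction_num_den v : fraction (num v) (den v) = v.
Proof. by case: v => [x|] //=; rewrite /fraction denq_eq0 divq_num_den. Qed.

Lemma fractionMl k a b : k != 0 -> fraction (k * a) (k * b) = fraction a b.
Proof.
move=> k0; rewrite /fraction mulf_eq0 (negPf k0) /=; case: eqP => // _.
by rewrite !intrM -mulf_div divff ?mul1r // intr_eq0.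
Qed.

Lemma fraction_scale a b : (a != 0) || (b != 0) ->
  exists2 k, k != 0 & a = k * num (fraction a b) /\ b = k * den (fraction a b).
Proof.
rewrite /fraction; case: (b =P 0) => [-> | /eqP b0 _] /=.
  by rewrite orbF => a0; exists a; rewrite ?mulr1 ?mulr0.
case: divqP b0 => [|k x k0 _]; first by rewrite eqxx.
by exists k.
Qed.

Lemma colvZ k v :
  k *: colv v = \col_i (if i == 0 then k * num v else k * den v).
Proof. by apply/colP => i; rewrite !mxE; case: ifP. Qed.

Lemma vertex_of_colZ k c : k != 0 -> vertex_of_col (k *: c) = vertex_of_col c.
Proof. by move=> k0; rewrite /vertex_of_col !mxE fractionMl. Qed.

Lemma vertex_of_colv v : vertex_of_col (colv v) = v.
Proof. by rewrite /vertex_of_col !mxE /= fraction_num_den. Qed.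

Lemma col2_neq0 (c : 'cV[int]_2) : (c != 0) = (c 0 0 != 0) || (c 1 0 != 0).
Proof.
rewrite -negb_and; congr negb; apply/eqP/andP => [-> | [/eqP c0 /eqP c1]].
  by rewrite !mxE.
apply/colP; case=> [[|[|//]] Hi]; rewrite mxE.
  by rewrite -[RHS]c0; congr (c _ _); apply: val_inj.
by rewrite -[RHS]c1; congr (c _ _); apply: val_inj.
Qed.

Lemma mobius_vertex_of_col (M : 'M[int]_2) c : c != 0 ->
  mobius M (vertex_of_col c) = vertex_of_col (M *m c).
Proof.
rewrite col2_neq0 => /fraction_scale [k k0 [e0 e1]].
have -> : c = k *: colv (vertex_of_col c).
  rewrite colvZ; apply/colP; case=> [[|[|//]] Hi]; rewrite mxE /=.
    by rewrite -[RHS]e0; congr (c _ _); apply: val_inj.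
  by rewrite -[RHS]e1; congr (c _ _); apply: val_inj.
by rewrite vertex_of_colZ // vertex_of_colv -scalemxAr vertex_of_colZ.
Qed.

Lemma colv_neq0 v : colv v != 0.
Proof. by rewrite col2_neq0 !mxE /= num_den_neq0. Qed.

Lemma mobius1 v : mobius 1%:M v = v.
Proof. by rewrite /mobius mul1mx vertex_of_colv. Qed.

Lemma mobiusM (M M' : 'M[int]_2) v : \det M' = 1 ->
  mobius (M *m M') v = mobius M (mobius M' v).
Proof.
move=> d; rewrite [mobius M' v]/mobius mobius_vertex_of_col ?mulmxA //.
have uM : M' \in unitmx by rewrite unitmxE d unitr1.
apply: contra_neq (colv_neq0 v) => e.
by rewrite -(mulKmx uM (colv v)) e mulmx0.
Qed.

Lemma sl2_equiv_refl N : reflexive (@sl2_equiv N).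
Proof.
move=> p; apply/asboolP; exists 1%:M; first exact: det1.
by move=> i _; rewrite mobius1.
Qed.

Lemma sl2_equiv_trans N : transitive (@sl2_equiv N).
Proof.
move=> q p r /asboolP [M dM Mpq] /asboolP [M' dM' Mqr]; apply/asboolP.
exists (M' *m M); first by rewrite det_mulmx dM dM' mulr1.
by move=> i iN; rewrite mobiusM // -Mpq // Mqr.
Qed.

Lemma sl2_equiv_sym N : symmetric (@sl2_equiv N).
Proof.
suff H p q : @sl2_equiv N p q -> sl2_equiv q p.
  by move=> p q; apply/idP/idP; apply: H.
move=> /asboolP [M dM Mpq]; apply/asboolP.
have uM : M \in unitmx by rewrite unitmxE dM unitr1.
exists (invmx M); first by rewrite det_inv dM invr1.
by move=> i iN; rewrite Mpq // -mobiusM // mulVmx // mobius1.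
Qed.

Canonical sl2_equiv_rel (N : nat) :=
  EquivRel (@sl2_equiv N) (@sl2_equiv_refl N) (@sl2_equiv_sym N)
    (@sl2_equiv_trans N).

Definition path_class (N : nat) := {eq_quot (@sl2_equiv N)}.
Definition class_of (N : nat) (p : cpath N) : path_class N :=
  \pi_(path_class N) p.

(* [pdiff x y] is [x - y] for finite points and, in general, the determinant of
   the coordinate vectors, taking [(x, 1)] for a finite point and [(1, 0)] for
   infinity. In the cross-ratio each point occurs once above and once below, so
   the factors involving an infinite point are replaced by the limit of their
   quotient. *)
Definition pdiff (F : fieldType) (x y : option F) : F :=
  match x, y with
  | Some x, Some y => x - y
  | None, Some _ => 1
  | Some _, None => - 1
  | None, None => 0
  end.

Definition cross_ratio (F : fieldType) (p q r s : option F) : F :=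
  (pdiff p s / pdiff p q) * (pdiff q r / pdiff r s).

(* A map on [yindex n] is extended by 0 to all pairs by [entry], so that the
   conditions on its values can be written without membership proofs. *)
Definition yindex (n : nat) : Type :=
  {x : int * int | 1 <= x.1 - x.2 <= n%:Z + 2}.

Definition entry (n : nat) (B : yindex n -> int) (i j : int) : int :=
  oapp B 0 (insub (i, j)).

Definition is_yfrieze (n : nat) (B : yindex n -> int) : Prop :=
  [/\ forall i : int, entry B (i + 1) i = 0 /\ entry B (i + n%:Z + 2) i = 0,
      forall i j : int, 2 <= i - j <= n%:Z + 1 -> 0 < entry B i j
    & forall i j : int, 2 <= i - j <= n%:Z + 1 ->
        (entry B i (j + 1) + 1) * (entry B (i + 1) j + 1)
        = entry B i j * entry B (i + 1) (j + 1)].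

Record yfrieze (n : nat) := YFrieze {
  yfun :> yindex n -> int;
  yfunP : is_yfrieze yfun }.

Lemma cross_ratio_fin (F : fieldType) (p q r s : F) :
  cross_ratio (Some p) (Some q) (Some r) (Some s)
  = (p - s) / (p - q) * ((q - r) / (r - s)).
Proof. by []. Qed.

Lemma before_total x y : x != y -> before x y || before y x.
Proof.
case: x => [x|]; case: y => [y|] //= h; rewrite -neq_lt.
by apply: contra_neq h => ->.
Qed.

Lemma before_trans : transitive before.
Proof.
move=> y x z; case: x => [x|]; case: y => [y|]; case: z => [z|] //= yx zy.
exact: lt_trans zy yx.
Qed.

Lemma before_asym x y : before x y -> before y x = false.
Proof.
case: x => [x|]; case: y => [y|] //= yx.
by apply/negbTE; rewrite -leNgt ltW.
Qed.

Lemma farey_edge_det x y : farey_edge x y -> before x y ->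
  num x * den y - den x * num y = 1.
Proof.
case: x => [x|]; case: y => [y|] //=; rewrite /farey_edge /=.
  move=> /orP[/eqP -> // | /eqP e] h; exfalso.
  have : numq y * denq x < numq x * denq y by rewrite -lt_ratE.
  lia.
have := denq_gt0 y; rewrite !mul1r mul0r subr0 => ? /orP[/eqP //|/eqP]; lia.
Qed.

Lemma farey_edgeC x y : farey_edge x y = farey_edge y x.
Proof.
rewrite /farey_edge orbC -[num x * _ - _]opprB eqr_opp eqr_oppLR.
by rewrite ![_ * den y]mulrC ![_ * num y]mulrC.
Qed.

Lemma farey_edge_neq x y : farey_edge x y -> x != y.
Proof.
apply: contraTneq => ->; rewrite /farey_edge [den y * _]mulrC subrr.
by [].
Qed.

Lemma biinfinite_lift_exists (N : nat) (p : cpath N) : (1 < N)%N ->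
  exists a b : int -> int, biinfinite_lift p a b.
Proof.
move=> N1; have N0 : (0 < N)%N by apply: ltnW.
case/and4P: (valP p) => /forallP edge /eqP close _ cw.
have {}edge i : (i < N)%N -> farey_edge (pvertex p i) (pvertex p i.+1).
  by move=> iN; apply: (edge (Ordinal iN)).
have {}cw i j k : (i < j < k)%N -> (k < N)%N ->
    clockwise (pvertex p i) (pvertex p j) (pvertex p k).
  move=> ijk kN; have /andP[ij jk] := ijk.
  have jN := ltn_trans jk kN; have iN := ltn_trans ij jN.
  move/forallP: cw => /(_ (Ordinal iN)) /forallP /(_ (Ordinal jN)).
  by move=> /forallP /(_ (Ordinal kN)) /implyP /(_ ijk).
have {}close : pvertex p N = pvertex p 0 by [].
pose c r : int := (-1) ^+ before (pvertex p r) (pvertex p 0).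
have c0 : c 0%N = 1.
  rewrite /c; case: (pvertex p 0) => [x|] //=.
  by rewrite ltxx.
have dnext x y : farey_edge x y ->
    (-1) ^+ before y x * (num x * den y - den x * num y) = 1.
  move=> e; have /orP[h|h] := before_total (farey_edge_neq e).
    by rewrite (before_asym h) expr0 mul1r farey_edge_det.
  have := farey_edge_det (etrans (farey_edgeC y x) e) h.
  rewrite h expr1; lia.
have cstep r : (r.+1 < N)%N ->
    c r * c r.+1 = (-1) ^+ before (pvertex p r.+1) (pvertex p r).
  case: r => [|r] rN; first by rewrite c0 mul1r.
  have cwr : clockwise (pvertex p 0) (pvertex p r.+1) (pvertex p r.+2).
    by apply: cw; rewrite //= ltnS.
  rewrite /c; have /or3P[] := cwr => /andP[h1 h2].
  - have h3 : before (pvertex p 0) (pvertex p r.+2)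
      by apply: before_trans h1 h2.
    by rewrite (before_asym h1) (before_asym h2) (before_asym h3).
  - have h3 : before (pvertex p r.+1) (pvertex p 0)
      by apply: before_trans h1 h2.
    by rewrite h2 h3 (before_asym h1).
  - have h3 : before (pvertex p r.+2) (pvertex p r.+1)
      by apply: before_trans h1 h2.
    by rewrite h1 h3 (before_asym h2).
have cwrap : c N.-1 * (num (pvertex p N.-1) * den (pvertex p 0)
                     - den (pvertex p N.-1) * num (pvertex p 0)) = - 1.
  have e := edge N.-1; rewrite prednK // close in e; have {}e := e (leqnn _).
  have := dnext _ _ e; rewrite /c.
  have /orP[h|h] := before_total (farey_edge_neq e);
    rewrite h (before_asym h) ?expr0 ?expr1; lia.
pose s (q : int) : int := (-1) ^ q.
have sS q : s (q + 1) = - s q by rewrite /s exprzDr // expr1z mulrN1.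
have ss q : s q * s q = 1.
  by rewrite /s -exprzMl ?unitrN1 // mulrNN mulr1 exp1rz.
pose w f (i : int) : int :=
  s (i %/ N)%Z * c `|i %% N|%Z%N * f (pvertex p `|i %% N|%Z%N).
have NZ : N%:Z != 0 by rewrite -lt0n.
have wE f (q : int) (r : nat) : (r < N)%N ->
    w f (q * N%:Z + r%:Z) = s q * c r * f (pvertex p r).
  move=> rN; rewrite /w modzMDl modz_small ?ltz_nat //.
  by rewrite divzMDl // divz_small ?addr0 //= ltz_nat.
have wN f (i : int) : w f (i + N%:Z) = - w f i.
  have -> : i + N = 1 * N%:Z + i by lia.
  by rewrite /w modzMDl divzMDl // addrC sS !mulNr.
have sV q : s q != 0.
  by apply/eqP => e; have := ss q; rewrite e mul0r.
have cV r : c r != 0 by rewrite /c signr_eq0.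
exists (w num), (w den); split; last by move=> i; rewrite !wN.
  move=> i; rewrite leq_eqVlt => /orP[/eqP -> | iN].
    have -> : N%:Z = 0 + N%:Z by rewrite add0r.
    rewrite !wN; have := wE num 0 0%N N0; rewrite mul0r addr0 => ->.
    have := wE den 0 0%N N0; rewrite mul0r addr0 => ->.
    rewrite -!mulNr fractionMl ?oppr_eq0 ?mulf_neq0 //.
    by rewrite fraction_num_den close.
  have := wE num 0 i iN; rewrite mul0r add0r => ->.
  have := wE den 0 i iN; rewrite mul0r add0r => ->.
  by rewrite fractionMl ?mulf_neq0 // fraction_num_den.
move=> i1; set i := i1 - 1; have -> : i1 = i + 1 by rewrite subrK.
have [r rN iE] : exists2 r, (r < N)%N & i = (i %/ N)%Z * N%:Z + r%:Z.
  have := modz_ge0 i NZ; have := ltz_pmod i (_ : 0 < N%:Z).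
  rewrite ltz_nat => /(_ N0); rewrite {3}(divz_eq i N%:Z).
  by case: (i %% N)%Z => // r rN _; exists r.
move: (i %/ N)%Z iE => q ->; rewrite !wE //.
have [rN1|] := boolP (r.+1 < N)%N.
  have -> : q * N%:Z + r%:Z + 1 = q * N%:Z + r.+1%:Z by lia.
  rewrite !wE //; have := dnext _ _ (edge _ rN); rewrite -cstep // => <-.
  by rewrite -[RHS]mul1r -(ss q); ring.
rewrite -leqNgt => Nr; have {Nr}rE : r = N.-1 by lia.
have -> : q * N%:Z + r%:Z + 1 = (q + 1) * N%:Z + 0%:Z by lia.
rewrite !wE // sS c0 rE.
transitivity (s q * s q * - (c N.-1 * (num (pvertex p N.-1) * den (pvertex p 0)
                     - den (pvertex p N.-1) * num (pvertex p 0)))).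
  by ring.
by rewrite cwrap ss.
Qed.

(* Main.v *)
(* For vectors (a i, b i) put D i j = a i * b j - b i * a j. Clockwise paths
   that turn once are those with D i j > 0 for i < j < i + N, and the
   cross-ratio of the edges (i, i + 1) and (j, j + 1) is
   D i (j + 1) * D (i + 1) j / (D i (i + 1) * D j (j + 1)), so the Y-frieze
   relation is a consequence of the Pluecker relation.

   For surjectivity, a single row of a Y-frieze prescribes the cross-ratios of
   the edge from 0 to infinity with the other edges, hence a decreasing sequence
   of rational points; by the Y-frieze relation all the other cross-ratios of
   this polygon are then also the entries of the Y-frieze. If a prime p divides
   some D i (i + 1), choose coordinates in which the i-th point is infinity.
   Since the cross-ratios are integers, every edge has an end congruent to
   infinity modulo p (in the Bruhat-Tits tree of PGL2 over the p-adic numbers,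
   the geodesics spanned by any two edges meet). So passing to the lattice of
   vectors with second coordinate divisible by p divides some of the
   determinants D j (j + 1) by p and increases none of them. Iterating, all of
   them become 1, and the polygon is a closed path in the Farey graph. *)
Require Import Defs.
From mathcomp Require Import all_boot all_order all_algebra.
From mathcomp Require Import boolp ring zify.
Set Implicit Arguments.
Unset Strict Implicit.
Unset Printing Implicit Defensive.

Import Order.TTheory GRing.Theory Num.Theory.
Local Open Scope ring_scope.
Local Open Scope quotient_scope.

(** * Determinants of antiperiodic sequences of vectors *)

Definition dt (a b : int -> int) (i j : int) : int := a i * b j - b i * a j.

Definition antiperiodic (N : nat) (f : int -> int) : Prop :=
  forall i : int, f (i + N%:Z) = - f i.

Lemma periodicE (T : Type) (N : nat) (f : int -> T) :
  (forall i, f (i + N%:Z) = f i) -> forall i, f i = f (i %% N)%Z.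
Proof.
move=> fN i.
have fq (q : nat) (j : int) : f (j + q%:Z * N%:Z) = f j.
  elim: q j => [|q IH] j; first by rewrite mul0r addr0.
  by rewrite intS mulrDl mul1r addrA IH fN.
rewrite {1}(divz_eq i N%:Z) addrC.
case: (i %/ N)%Z => q; first exact: fq.
by rewrite -(fq q.+1) NegzE -addrA mulNr addNr addr0.
Qed.

Lemma modz_nat (N : nat) (i : int) : (0 < N)%N ->
  exists2 r : nat, (r < N)%N & (i %% N)%Z = r%:Z.
Proof.
move=> N0; have NZ : N%:Z != 0 by rewrite -lt0n.
have := modz_ge0 i NZ; have := ltz_pmod i (_ : 0 < N%:Z).
by rewrite ltz_nat => /(_ N0); case: (i %% N)%Z => // r rN _; exists r.
Qed.

Definition antiext (N : nat) (f : nat -> int) (i : int) : int :=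
  (-1) ^ (i %/ N)%Z * f `|i %% N|%Z%N.

Lemma antiext_antiperiodic (N : nat) f : (0 < N)%N ->
  antiperiodic N (antiext N f).
Proof.
move=> N0 i; have NZ : N%:Z != 0 by rewrite -lt0n.
rewrite /antiext [i + _]addrC -[X in X + i]mul1r modzMDl divzMDl // addrC.
by rewrite exprzDr // expr1z mulrN1 mulNr.
Qed.

Lemma antiextE (N : nat) f (r : nat) : (r < N)%N -> antiext N f r%:Z = f r.
Proof.
move=> rN; rewrite /antiext divz_small ?modz_small ?ltz_nat //=.
by rewrite expr0z mul1r.
Qed.

Lemma dt_anti a b i j : dt a b i j = - dt a b j i.
Proof. rewrite /dt; ring. Qed.

Lemma dtNl N a b i j : antiperiodic N a -> antiperiodic N b ->
  dt a b (i + N%:Z) j = - dt a b i j.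
Proof. by move=> aN bN; rewrite /dt aN bN; ring. Qed.

Lemma dtNr N a b i j : antiperiodic N a -> antiperiodic N b ->
  dt a b i (j + N%:Z) = - dt a b i j.
Proof. by move=> aN bN; rewrite /dt aN bN; ring. Qed.

Definition turns_once (N : nat) (a b : int -> int) : Prop :=
  [/\ antiperiodic N a, antiperiodic N b
    & forall i j : int, i < j < i + N%:Z -> 0 < dt a b i j].

(** Shifting both indices by [N] preserves [dt], so [i] moves into one period. If [j] then passes
    [N], the sign from moving it back is absorbed by antisymmetry. *)
Lemma turns_onceP N a b : (0 < N)%N -> antiperiodic N a -> antiperiodic N b ->
  (forall i j : nat, (i < j < N)%N -> 0 < dt a b i j) -> turns_once N a b.
Proof.
move=> N0 aN bN pos; split=> // i j ij.
set d := j - i; have -> : j = i + d by rewrite /d; lia.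
have -> : dt a b i (i + d) = dt a b (i %% N)%Z ((i %% N)%Z + d).
  apply: (@periodicE _ N (fun i => dt a b i (i + d))) => k.
  by rewrite addrAC dtNl // dtNr // opprK.
have [r rN ->] := modz_nat i N0.
have [k kE] : exists k : nat, r%:Z + d = k%:Z
  by exists (absz (r%:Z + d)); rewrite /d; lia.
rewrite kE; have [kN|Nk] := ltnP k N; first by apply: pos; rewrite /d in kE; lia.
have -> : k = ((k - N)%N%:Z + N%:Z) :> int by lia.
by rewrite dtNr // -dt_anti; apply: pos; rewrite /d in kE; lia.
Qed.

(** * Clockwise order in terms of determinants *)

Definition vdet (x y : vertex) : int := num x * den y - den x * num y.

(** Representatives have nonnegative denominators and infinity is [1/0], so signs of determinants
    compare points in the order cut at infinity. *)
Lemma vdet_gt0 x y : (0 < vdet x y) = before x y.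
Proof.
case: x => [x|]; case: y => [y|]; rewrite /vdet /before /=.
- by rewrite subr_gt0 -[RHS]/(lt_rat y x) lt_ratE [denq x * _]mulrC.
- by rewrite mulr0 mulr1 sub0r oppr_gt0 ltNge denq_ge0.
- by rewrite mul1r mul0r subr0 denq_gt0.
- by [].
Qed.

Lemma vdet_anti x y : vdet x y = - vdet y x.
Proof. rewrite /vdet; ring. Qed.

(** By transitivity the determinants of [x y], [y z] and [z x] are never all positive or all
    negative. So two of them are positive exactly when their product is negative, and [vdet x z] is
    minus the last one. *)
Lemma clockwise_vdet x y z :
  clockwise x y z = (0 < vdet x y * vdet y z * vdet x z).
Proof.
rewrite /clockwise -!vdet_gt0 (vdet_anti z x) oppr_gt0.
have tr u v w : 0 < vdet u v -> 0 < vdet v w -> 0 < vdet u w.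
  by rewrite !vdet_gt0; apply: before_trans.
have t1 := tr x y z; have t2 := tr z y x; have t3 := tr z x y.
have t4 := tr y z x.
move: t1 t2 t3 t4; rewrite (vdet_anti z y) (vdet_anti y x) (vdet_anti z x).
move: (vdet x y) (vdet y z) (vdet x z) => A B C.
rewrite !oppr_gt0 -[X in _ = X]sgr_gt0 !sgrM.
case: (ltrgt0P A) => A0; case: (ltrgt0P B) => B0; case: (ltrgt0P C) => C0 //=;
  move=> t1 t2 t3 t4;
  rewrite ?A0 ?B0 ?C0 ?(gtr0_sg A0) ?(gtr0_sg B0) ?(gtr0_sg C0)
    ?(ltr0_sg A0) ?(ltr0_sg B0) ?(ltr0_sg C0) ?sgr0 ?mul0r ?mulr0 ?ltxx //;
  by [move: (t1 isT isT) | move: (t2 isT isT) | move: (t3 isT isT)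
     | move: (t4 isT isT)].
Qed.

Lemma fraction_vdet (a b c d : int) : (a != 0) || (b != 0) ->
    (c != 0) || (d != 0) ->
  exists2 k, k != 0 & a * d - b * c = k * vdet (fraction a b) (fraction c d).
Proof.
move=> /fraction_scale [k k0 [ea eb]] /fraction_scale [l l0 [ec ed]].
exists (k * l); first by rewrite mulf_neq0.
move: (fraction a b) (fraction c d) ea eb ec ed => u v -> -> -> ->.
by rewrite /vdet; ring.
Qed.

Definition nonzero (a b : int -> int) (i : int) := (a i != 0) || (b i != 0).

(** Each index occurs twice in the product of determinants, so rescaling the three vectors
    multiplies it by a square. *)
Lemma clockwise_fraction a b i j k :
    nonzero a b i -> nonzero a b j -> nonzero a b k ->
  clockwise (fraction (a i) (b i)) (fraction (a j) (b j)) (fraction (a k) (b k))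
  = (0 < dt a b i j * dt a b j k * dt a b i k).
Proof.
move=> /fraction_scale [x x0 [ai bi]] /fraction_scale [y y0 [aj bj]]
  /fraction_scale [z z0 [ak bk]].
rewrite /dt; move: (fraction _ _) (fraction _ _) (fraction _ _) ai bi aj bj ak bk.
move=> u v w -> -> -> -> -> ->; rewrite clockwise_vdet.
rewrite -[LHS](@pmulr_rgt0 _ ((x * y * z) ^+ 2)); last first.
  by rewrite exprn_even_gt0 //= !mulf_neq0.
by congr (_ < _); rewrite /vdet; ring.
Qed.

(** * Cross-ratios as quotients of determinants *)

Lemma dt_neq0l a b i j : dt a b i j != 0 -> nonzero a b i.
Proof.
rewrite /nonzero -negb_and; apply: contra => /andP[/eqP ai /eqP bi].
by rewrite /dt ai bi !mul0r subrr.
Qed.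

(* The factor between (a, b) and the coordinate vector used by [pdiff]. *)
Definition hcoord (a b : int) : rat := if b == 0 then a%:~R else b%:~R.

Lemma hcoord_neq0 a b : (a != 0) || (b != 0) -> hcoord a b != 0.
Proof. by rewrite /hcoord; case: ifP => b0; rewrite intr_eq0 ?b0 // orbF. Qed.

Lemma pdiff_fraction a b c d : (a != 0) || (b != 0) -> (c != 0) || (d != 0) ->
  pdiff (fraction a b) (fraction c d)
  = (a * d - b * c)%:~R / (hcoord a b * hcoord c d).
Proof.
rewrite /hcoord /fraction.
case: (eqVneq b 0) => [->|b0]; case: (eqVneq d 0) => [->|d0] /=;
  rewrite ?orbF ?orbT => h1 h2.
- by rewrite mulr0 mul0r subrr mul0r.
- by rewrite mul0r subr0 intrM divff // mulf_neq0 ?intr_eq0.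
- by rewrite mulr0 sub0r intrN intrM mulNr divff // mulf_neq0 ?intr_eq0.
- by rewrite intrB !intrM; field; rewrite !intr_eq0 b0 d0.
Qed.

Lemma cross_ratio_fraction a b (p q r s : int) :
    dt a b p q != 0 -> dt a b r s != 0 ->
  cross_ratio (fraction (a p) (b p)) (fraction (a q) (b q))
     (fraction (a r) (b r)) (fraction (a s) (b s))
  = (dt a b p s * dt a b q r)%:~R / (dt a b p q * dt a b r s)%:~R.
Proof.
move=> pq rs.
have np := dt_neq0l pq; have nr := dt_neq0l rs.
have nq : nonzero a b q by apply: (@dt_neq0l a b q p); rewrite dt_anti oppr_eq0.
have ns : nonzero a b s by apply: (@dt_neq0l a b s r); rewrite dt_anti oppr_eq0.
rewrite /cross_ratio !pdiff_fraction // -![a _ * b _ - _]/(dt a b _ _) !intrM.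
have := hcoord_neq0 np; have := hcoord_neq0 nq.
have := hcoord_neq0 nr; have := hcoord_neq0 ns.
move: (hcoord _ _) (hcoord _ _) (hcoord _ _) (hcoord _ _)
  => hs hr hq hp s0 r0 q0 p0.
have Dpq : (dt a b p q)%:~R != 0 :> rat by rewrite intr_eq0.
have Drs : (dt a b r s)%:~R != 0 :> rat by rewrite intr_eq0.
by field; rewrite Dpq Drs p0 q0 r0 s0.
Qed.

(** * Biinfinite lifts of clockwise paths *)

Lemma lift_dt1 N (p : cpath N) a b : biinfinite_lift p a b ->
  forall i, dt a b i (i + 1) = 1.
Proof. by case=> _ d1 _ i; have := d1 (i + 1); rewrite addrK. Qed.

(** Induction on [j] with [i] fixed: as [dt a b j (j + 1)] is 1, the clockwise triple [i], [j],
    [j + 1] forces [dt a b i j] and [dt a b i (j + 1)] to have the same sign. *)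
Lemma lift_turns_once N (p : cpath N) a b : (0 < N)%N ->
  biinfinite_lift p a b -> turns_once N a b.
Proof.
move=> N0 lift; have d1 := lift_dt1 lift; have [fr _ anti] := lift.
have nz i : nonzero a b i by apply: (@dt_neq0l a b i (i + 1)); rewrite d1.
apply: turns_onceP => // [i|i|i j];
  [by have [] := anti i | by have [] := anti i |].
case/and4P: (valP p) => _ _ _ cw.
elim: j => // j IH /andP[]; rewrite ltnS leq_eqVlt => /orP[/eqP <- | ij] jN.
  by rewrite -addn1 PoszD d1.
have {}cw : clockwise (pvertex p i) (pvertex p j) (pvertex p j.+1).
  have jN' := ltnW jN; have iN := ltn_trans ij jN'.
  move/forallP: cw => /(_ (Ordinal iN)) /forallP /(_ (Ordinal jN')).
  by move=> /forallP /(_ (Ordinal jN)) /implyP; apply; rewrite /= ij ltnSn.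
move: cw; rewrite -!fr ?clockwise_fraction; try by lia || exact: nz.
rewrite -[j.+1]addn1 PoszD d1 mulr1 pmulr_rgt0 //; apply: IH; lia.
Qed.

(** The sign change over a period disappears in the fraction, so the vertices extend periodically.
    Cross-ratios can thus be taken at all integers without choosing a lift. *)
Definition pv N (p : cpath N) (i : int) : vertex := pvertex p `|(i %% N)%Z|%N.

Lemma lift_fraction N (p : cpath N) a b i : (0 < N)%N ->
  biinfinite_lift p a b -> fraction (a i) (b i) = pv p i.
Proof.
move=> N0 [fr _ anti]; rewrite (@periodicE _ N (fun i => fraction (a i) (b i))).
  by rewrite /pv; have [r rN ->] := modz_nat i N0; apply: fr; apply: ltnW.
move=> k; have [-> ->] := anti k.
by rewrite -mulN1r -[- b k]mulN1r fractionMl.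
Qed.

(** * The Y-frieze of a path and its invariance under SL2 *)

Lemma yfrieze_of_fun (n : nat) (F : int -> int -> int) :
    (forall i, F (i + 1) i = 0) -> (forall i, F (i + n%:Z + 2) i = 0) ->
    (forall i j, 2 <= i - j <= n%:Z + 1 -> 0 < F i j) ->
    (forall i j, 2 <= i - j <= n%:Z + 1 ->
      (F i (j + 1) + 1) * (F (i + 1) j + 1) = F i j * F (i + 1) (j + 1)) ->
  exists B : yfrieze n,
    forall i j, 1 <= i - j <= n%:Z + 2 -> entry B i j = F i j.
Proof.
move=> F0 F1 Fpos Frec; pose B (x : yindex n) := F (val x).1 (val x).2.
have BE i j : 1 <= i - j <= n%:Z + 2 -> entry B i j = F i j.
  by move=> ij; rewrite /entry insubT.
suff PB : is_yfrieze B by exists (YFrieze PB).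
split=> [i|i j ij|i j ij]; first by rewrite !BE ?F0 ?F1 //; lia.
  by rewrite BE ?Fpos //; lia.
by rewrite !BE ?Frec //; lia.
Qed.

Lemma pluecker a b (i j : int) :
  dt a b i (j + 1) * dt a b (i + 1) j + dt a b i (i + 1) * dt a b j (j + 1)
  = dt a b i j * dt a b (i + 1) (j + 1).
Proof. by rewrite /dt; ring. Qed.

Lemma yfrieze_of_dt (n : nat) a b : turns_once (n + 3) a b ->
    (forall i, dt a b i (i + 1) = 1) ->
  exists B : yfrieze n, forall i j, 1 <= i - j <= n%:Z + 2 ->
    entry B i j = dt a b i (j + 1) * dt a b (i + 1) j.
Proof.
move=> [aN bN pos] d1.
apply: (@yfrieze_of_fun n (fun i j => dt a b i (j + 1) * dt a b (i + 1) j))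
  => [i|i|i j ij|i j ij].
- by rewrite [X in X * _](_ : _ = 0) ?mul0r // /dt; ring.
- have -> : i + n%:Z + 2 + 1 = i + (n + 3)%N%:Z by lia.
  by rewrite (dtNl _ _ aN bN) [dt a b i i](_ : _ = 0) ?oppr0 ?mulr0 // /dt; ring.
- by rewrite dt_anti [dt a b (i + 1) j]dt_anti mulrNN mulr_gt0 ?pos //; lia.
(* The Pluecker relations at [(i, j + 1)] and [(i + 1, j)] give the two factors on the left; their
   product regroups into the two entries on the right. *)
have pl k l := pluecker a b k l.
by move: (pl i (j + 1)) (pl (i + 1) j); rewrite !d1 mulr1 => -> ->; ring.
Qed.

Definition path_cross_ratio N (p : cpath N) (i j : int) : rat :=
  cross_ratio (pv p i) (pv p (i + 1)) (pv p j) (pv p (j + 1)).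

Lemma path_cross_ratioE N (p : cpath N) a b i j : (0 < N)%N ->
    biinfinite_lift p a b ->
  path_cross_ratio p i j = (dt a b i (j + 1) * dt a b (i + 1) j)%:~R.
Proof.
move=> N0 lift; have d1 := lift_dt1 lift.
rewrite /path_cross_ratio -!(lift_fraction _ N0 lift) cross_ratio_fraction !d1 //.
by rewrite mulr1 divr1.
Qed.

Lemma yfrieze_of_path (n : nat) (p : cpath (n + 3)) :
  exists B : yfrieze n, forall i j, 1 <= i - j <= n%:Z + 2 ->
    (entry B i j)%:~R = path_cross_ratio p i j.
Proof.
have N0 : (0 < n + 3)%N by lia.
have N1 : (1 < n + 3)%N by lia.
have [a [b lift]] := biinfinite_lift_exists p N1.
have [B BE] := yfrieze_of_dt (lift_turns_once N0 lift) (lift_dt1 lift).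
by exists B => i j ij; rewrite (path_cross_ratioE _ _ N0 lift) BE.
Qed.

(** Applying [M] to a lift of [p] gives vectors with the same determinants that represent the
    vertices of [q]. *)
Lemma path_cross_ratio_sl2 N (p q : cpath N) i j : (1 < N)%N ->
  sl2_equiv p q -> path_cross_ratio p i j = path_cross_ratio q i j.
Proof.
move=> N1 /asboolP [M dM Mpq]; have N0 := ltnW N1.
have [a [b lift]] := biinfinite_lift_exists p N1; have d1 := lift_dt1 lift.
pose a' k := M 0 0 * a k + M 0 1 * b k; pose b' k := M 1 0 * a k + M 1 1 * b k.
have dt' k l : dt a' b' k l = dt a b k l.
  have e1 : fintype.lift 0 0 = 1 :> 'I_2 by apply: val_inj.
  have e0 : fintype.lift 1 0 = 0 :> 'I_2 by apply: val_inj.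
  rewrite -[RHS]mul1r -dM (expand_det_row _ 0) !big_ord_recl big_ord0 /cofactor.
  rewrite !det_mx11 !mxE /= !e1 e0 expr0 expr1 /dt /a' /b'; ring.
have fr' k : fraction (a' k) (b' k) = pv q k.
  have [r rN rE] := modz_nat k N0.
  have -> : pv q k = mobius M (pv p k) by rewrite /pv rE; apply: Mpq; apply: ltnW.
  rewrite -(lift_fraction _ N0 lift).
  have nz : nonzero a b k by apply: (@dt_neq0l a b k (k + 1)); rewrite d1.
  pose c : 'cV[int]_2 := \col_i (if i == 0 then a k else b k).
  have -> : fraction (a k) (b k) = vertex_of_col c.
    by rewrite /vertex_of_col !mxE.
  rewrite mobius_vertex_of_col; last by rewrite col2_neq0 !mxE.
  rewrite /vertex_of_col !mxE !big_ord_recl !big_ord0 !mxE /= !addr0.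
  by have -> : fintype.lift ord0 ord0 = 1 :> 'I_2 by apply: val_inj.
rewrite (path_cross_ratioE _ _ N0 lift) /path_cross_ratio -!fr'.
by rewrite cross_ratio_fraction !dt' !d1 // mulr1 divr1.
Qed.

(** * Polygons with integral cross-ratios and their reduction to unimodular ones *)

(** The integer function [B] covers all pairs of edges, beyond the index range of a Y-frieze, since
    the reduction compares one edge with every other. The consecutive determinants are arbitrary
    positive integers. *)
Definition integral_polygon (N : nat) (B : int -> int -> int)
    (a b : int -> int) : Prop :=
  [/\ turns_once N a b, forall i, coprimez (a i) (b i)
    & forall i j, B i j * (dt a b i (i + 1) * dt a b j (j + 1))
                  = dt a b i (j + 1) * dt a b (i + 1) j].

(** A Bezout relation for the coprime pair [(a i, b i)] completes it to a matrix of determinant 1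
    that sends the [i]-th point to infinity. *)
Lemma integral_polygon_rebase N B a b i : integral_polygon N B a b ->
  exists a' b', [/\ integral_polygon N B a' b', a' i = 1, b' i = 0
    & forall k l, dt a' b' k l = dt a b k l].
Proof.
move=> [[aN bN pos] cop cr]; have /coprimezP [[x y] /= xy] := cop i.
pose a' k := x * a k + y * b k; pose b' k := a i * b k - b i * a k.
have dt' k l : dt a' b' k l = dt a b k l.
  by rewrite -[RHS]mul1r -xy /dt /a' /b'; ring.
exists a', b'; split=> //; last by rewrite /b'; ring.
split; first split=> [k|k|k l kl]; rewrite ?dt' //.
- by rewrite /a' aN bN; ring.
- by rewrite /b' aN bN; ring.
- exact: pos.
- move=> k; have /coprimezP [[u v] /= uv] := cop k.
  (* The Bezout row [(u, v)] multiplied by the inverse of the base change. *)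
  apply/coprimezP; exists (u * a i + v * b i, v * x - u * y) => /=.
  by rewrite -uv -[RHS]mul1r -xy /a' /b'; ring.
- by move=> k l; rewrite !dt' cr.
Qed.

Lemma Euclid_dvdzM (p : nat) (x y : int) : prime p ->
  (p %| x * y)%Z = (p %| x)%Z || (p %| y)%Z.
Proof. by move=> pp; rewrite !dvdzE abszM Euclid_dvdM. Qed.

(* D' = D * s * s / p, where s = 1 at the points congruent to infinity modulo p
   and s = p at the others. *)
Lemma integral_polygon_contract N B a b i (p : nat) : (1 < N)%N ->
    integral_polygon N B a b -> a i = 1 -> b i = 0 ->
    prime p -> (p %| b (i + 1))%Z ->
  exists a' b', [/\ integral_polygon N B a' b',
    forall k, dt a' b' k (k + 1) <= dt a b k (k + 1)
    & p%:Z * dt a' b' i (i + 1) = dt a b i (i + 1)].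
Proof.
move=> N1 [[aN bN pos] cop cr] ai bi pp pi1.
have p0 : 0 < p%:Z by rewrite ltz_nat prime_gt0.
have pn0 : p%:Z != 0 by rewrite gt_eqF.
have dt_gt0 k : 0 < dt a b k (k + 1) by apply: pos; lia.
(* Every edge has an end congruent to infinity: [p] divides [b (i + 1)], the determinant of edge
   [i], hence by [cr] also [b (k + 1) * dt a b (i + 1) k]. Modulo [p] the last factor is
   [a (i + 1) * b k], and coprimality makes [a (i + 1)] nonzero. *)
have pb k : (p %| b k)%Z || (p %| b (k + 1))%Z.
  rewrite orbC; have : (p %| dt a b i (k + 1) * dt a b (i + 1) k)%Z.
    rewrite -cr dvdz_mull // dvdz_mulr //.
    by rewrite /dt ai bi mul0r subr0 mul1r.
  rewrite Euclid_dvdzM // {1 2}/dt ai bi mul0r mul1r subr0 => /orP[-> //|].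
  rewrite rpredBr; last by rewrite dvdz_mulr.
  rewrite Euclid_dvdzM // => /orP[pa|->]; last by rewrite orbT.
  have /coprimezP [[u v] /= uv] := cop (i + 1).
  have : (p %| (1 : int))%Z by rewrite -uv rpredD // dvdz_mull.
  by rewrite dvdzE /= dvdn1 => /eqP p1; move: pp; rewrite p1.
pose s k : int := if (p %| b k)%Z then 1 else p%:Z.
have s0 k : 0 < s k by rewrite /s; case: ifP.
have sN (k : int) : s (k + N%:Z) = s k by rewrite /s bN rpredN.
pose a' k := s k * a k; pose b' k := ((s k * b k) %/ p)%Z.
have b'E k : p%:Z * b' k = s k * b k.
  rewrite mulrC divzK // /s; case: ifP => [pk|_]; first by rewrite mul1r.
  exact: dvdz_mulr.
have dt' k l : p%:Z * dt a' b' k l = s k * s l * dt a b k l.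
  transitivity (a' k * (p%:Z * b' l) - (p%:Z * b' k) * a' l).
    by rewrite /dt; ring.
  by rewrite !b'E /a' /dt; ring.
have pI := mulfI pn0.
exists a', b'; split; last first.
- by rewrite dt' /s bi dvdz0 pi1 !mul1r.
(* By [pb] at most one of [s k] and [s (k + 1)] is [p], so their product is at most [p]. *)
- move=> k; rewrite -(ler_pM2l p0) dt' ler_pM2r // /s.
  by case/orP: (pb k) => ->; case: ifP;
    rewrite ?mul1r ?mulr1 // -ltz_nat ltW // ltz_nat prime_gt1.
split.
- split=> [k|k|k l kl].
  + by rewrite /a' sN aN mulrN.
  + by apply: (pI); rewrite mulrN !b'E sN bN mulrN.
  + by rewrite -(pmulr_rgt0 _ p0) dt' !mulr_gt0 ?pos.
(* Either [b k] loses a factor [p], or [a k] gains one while [b' k = b k] is prime to [p]. *)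
- move=> k; have := cop k; have := b'E k; rewrite /a' /s.
  case: ifP => pk; first by rewrite !mul1r => <-; rewrite coprimezMr => /andP[].
  move=> /pI ->; rewrite coprimezMl => ->; rewrite andbT.
  by rewrite coprimezE prime_coprime // -dvdzE pk.
(* After multiplication by [p] twice, both sides are the old ones times
   [s k * s (k + 1) * s l * s (l + 1)]. *)
move=> k l; apply: (pI); apply: (pI).
transitivity (B k l * ((p%:Z * dt a' b' k (k + 1)) * (p%:Z * dt a' b' l (l + 1)))).
  by ring.
transitivity ((p%:Z * dt a' b' k (l + 1)) * (p%:Z * dt a' b' (k + 1) l)).
  rewrite !dt'; transitivity (s k * s (k + 1) * s l * s (l + 1) *
    (B k l * (dt a b k (k + 1) * dt a b l (l + 1)))); first by ring.
  by rewrite cr; ring.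
by ring.
Qed.

(** With the [i]-th point at infinity the determinant of edge [i] is [b (i + 1)], so any prime
    factor of it allows a contraction. *)
Lemma integral_polygon_reduce N B a b i : (1 < N)%N ->
    integral_polygon N B a b -> 1 < dt a b i (i + 1) ->
  exists a' b', [/\ integral_polygon N B a' b',
    forall k, dt a' b' k (k + 1) <= dt a b k (k + 1)
    & dt a' b' i (i + 1) < dt a b i (i + 1)].
Proof.
move=> N1 /(@integral_polygon_rebase _ _ _ _ i) [a1 [b1 [poly ai bi dtE]]] d1.
have d1E : dt a1 b1 i (i + 1) = b1 (i + 1) by rewrite /dt ai bi mul1r mul0r subr0.
have b1gt : 1 < b1 (i + 1) by rewrite -d1E dtE.
have pp : prime (pdiv `|b1 (i + 1)|).
  by apply: pdiv_prime; case: (b1 _) b1gt.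
have pb : (pdiv `|b1 (i + 1)| %| b1 (i + 1))%Z by rewrite dvdzE pdiv_dvd.
have [a' [b' [poly' le' eq']]] := integral_polygon_contract N1 poly ai bi pp pb.
exists a', b'; split=> // [k|]; first by rewrite -dtE.
have D0 : 0 < dt a' b' i (i + 1).
  by case: poly' => [[_ _ pos] _ _]; apply: pos; lia.
by rewrite -dtE -eq' ltr_pMl // ltz_nat prime_gt1.
Qed.

(** Descent on the sum of the consecutive determinants over one period. *)
Lemma integral_polygon_unimodular N B a b : (1 < N)%N ->
    integral_polygon N B a b ->
  exists a' b', integral_polygon N B a' b' /\ forall i, dt a' b' i (i + 1) = 1.
Proof.
move=> N1; pose mu a b := (\sum_(k < N) `|dt a b k%:Z (k%:Z + 1)|)%N.
have [m] := ubnP (mu a b); elim: m => // m IH in a b * => lem poly.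
have [[aN bN pos] _ _] := poly.
have dt_gt0 k : 0 < dt a b k (k + 1) by apply: pos; lia.
have [/forallP all1 | /forallPn /= [k dk]] :=
  boolP [forall k : 'I_N, dt a b k%:Z (k%:Z + 1) == 1].
  exists a, b; split=> // i; rewrite (@periodicE _ N (fun i => dt a b i (i + 1))).
    by have [r rN ->] := modz_nat i (ltnW N1); apply/eqP: (all1 (Ordinal rN)).
  by move=> j; rewrite -addrA [_ + 1]addrC addrA dtNl // dtNr // opprK.
have d1 : 1 < dt a b k%:Z (k%:Z + 1) by have := dt_gt0 k; lia.
have [a' [b' [poly' le' lt']]] := integral_polygon_reduce N1 poly d1.
apply: (IH a' b') => //; rewrite -ltnS; apply: leq_trans lem; rewrite ltnS.
have pos' j : 0 < dt a' b' j (j + 1).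
  by case: poly' => [[_ _ pos'] _ _]; apply: pos'; lia.
rewrite /mu (bigD1 k) //= [in X in (_ < X)%N](bigD1 k) //= -addSn leq_add //.
  by move: lt' (pos' k); lia.
by apply: leq_sum => j _; move: (le' j) (pos' j); lia.
Qed.

(** * Propagation of cross-ratios from one row of a Y-frieze to all rows *)

Definition cross_rel (n : nat) (B : yfrieze n) (a b : int -> int) (i j : int) :=
  entry B i j * (dt a b i (i + 1) * dt a b j (j + 1))
  = dt a b i (j + 1) * dt a b (i + 1) j.

Section Propagation.
Variables (n : nat) (B : yfrieze n) (a b : int -> int).
Hypothesis turn : turns_once (n + 3) a b.

Lemma cross_rel_first i : cross_rel B a b (i + 1) i.
Proof.
have [/(_ i) [B0 _] _ _] := yfunP B.
by rewrite /cross_rel B0 /dt; ring.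
Qed.

Lemma cross_rel_last j : cross_rel B a b (j + n%:Z + 2) j.
Proof.
have [aN bN _] := turn; have [/(_ j) [_ B0] _ _] := yfunP B.
rewrite /cross_rel B0 (_ : j + n%:Z + 2 + 1 = j + (n + 3)%N%:Z); last by lia.
by rewrite (dtNl _ _ aN bN) /dt; ring.
Qed.

Lemma cross_rel_gt0 i j : 2 <= i - j <= n%:Z + 1 ->
  0 < dt a b i (j + 1) * dt a b (i + 1) j.
Proof.
have [aN bN pos] := turn => ij.
by rewrite dt_anti [dt a b (i + 1) j]dt_anti mulrNN mulr_gt0 ?pos //; lia.
Qed.

(** The Y-frieze and Pluecker relations express the product of these two corners in the same way
    through the other two. Positivity allows cancelling one of them. *)
Lemma cross_rel_square i j : 2 <= i - j <= n%:Z + 1 ->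
    cross_rel B a b i (j + 1) -> cross_rel B a b (i + 1) j ->
  cross_rel B a b i j <-> cross_rel B a b (i + 1) (j + 1).
Proof.
move=> ij; have [_ _ /(_ i j ij)] := yfunP B; rewrite /cross_rel.
have := cross_rel_gt0 ij; have := @cross_rel_gt0 (i + 1) (j + 1).
rewrite (_ : i + 1 - (j + 1) = i - j); last by ring.
move=> /(_ ij); move: (pluecker a b i (j + 1)) (pluecker a b (i + 1) j).
move: (entry B i j) (entry B i (j + 1)) (entry B (i + 1) j)
  (entry B (i + 1) (j + 1)) => Z X Y W.
set w0 := dt a b (i + 1) (j + 1 + 1) * dt a b (i + 1 + 1) (j + 1).
set z0 := dt a b i (j + 1) * dt a b (i + 1) j.
move=> pX pY w_gt0 z_gt0 rec cX cY.
set z := Z * _; set w := W * _.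
have zw : z * w = z0 * w0.
  transitivity (((X * (dt a b i (i + 1) * dt a b (j + 1) (j + 1 + 1)))
                   + dt a b i (i + 1) * dt a b (j + 1) (j + 1 + 1))
     * ((Y * (dt a b (i + 1) (i + 1 + 1) * dt a b j (j + 1)))
                   + dt a b (i + 1) (i + 1 + 1) * dt a b j (j + 1))).
    transitivity ((Z * W) * (dt a b i (i + 1) * dt a b j (j + 1)
      * (dt a b (i + 1) (i + 1 + 1) * dt a b (j + 1) (j + 1 + 1)))).
      by rewrite /z /w; ring.
    by rewrite -rec; ring.
  by rewrite cX cY pX pY /z0 /w0; ring.
split=> e; move: zw; rewrite e; first by apply: mulfI; rewrite gt_eqF.
by apply: mulIf; rewrite gt_eqF.
Qed.

Definition cross_row i :=
  forall j, 1 <= i - j <= n%:Z + 2 -> cross_rel B a b i j.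

(** The new row is filled from its boundary zero at [j = i + 1 - (n + 2)] upwards in [j], one square
    at a time. *)
Lemma cross_row_succ i : cross_row i -> cross_row (i + 1).
Proof.
move=> row j ij; have [m] : exists m : nat, n%:Z + 2 - (i + 1 - j) = m%:Z.
  by exists (absz (n%:Z + 2 - (i + 1 - j))%R); lia.
elim: m j ij => [|m IH] j ij mE.
  have -> : i + 1 = j + n%:Z + 2 by lia.
  exact: cross_rel_last.
have [->|ji] := eqVneq j i; first exact: cross_rel_first.
have -> : j = j - 1 + 1 by ring.
apply/(@cross_rel_square i (j - 1)); first by lia.
- by rewrite subrK; apply: row; lia.
- by apply: IH; lia.
- by apply: row; lia.
Qed.

(** Here the row is filled from the other boundary zero, at [j = i - 1], downwards in [j]. *)
Lemma cross_row_pred i : cross_row (i + 1) -> cross_row i.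
Proof.
move=> row j ij; have [m] : exists m : nat, i - j - 1 = m%:Z.
  by exists (absz (i - j - 1)%R); lia.
elim: m j ij => [|m IH] j ij mE.
  have -> : i = j + 1 by lia.
  exact: cross_rel_first.
have [->|ji] := eqVneq i (j + n%:Z + 2); first exact: cross_rel_last.
apply/(@cross_rel_square i j); first by lia.
- by apply: IH; lia.
- by apply: row; lia.
- by apply: row; lia.
Qed.

Lemma cross_row_all i0 : cross_row i0 -> forall i, cross_row i.
Proof.
move=> row0 i; have -> : i = i0 + (i - i0) by ring.
case: (i - i0) => [k|k]; last rewrite NegzE; elim: k => [|k IH].
- by rewrite addr0.
- by rewrite -addn1 PoszD addrA; apply: cross_row_succ.
- by apply: cross_row_pred; rewrite subrK.
- by apply: cross_row_pred; rewrite (_ : _ + 1 = i0 - k.+1%:Z) //; lia.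
Qed.

(** Divisibility of [e i j] by [d i j] depends only on [i - j] modulo [n + 3]. Nonzero residues lie
    in the range of the Y-frieze, and at residue 0 the cross-ratio is -1. *)
Lemma cross_row_extend :
    (forall i, cross_row i) ->
  exists C : int -> int -> int,
    (forall i j, 1 <= i - j <= n%:Z + 2 -> C i j = entry B i j) /\
    (forall i j, C i j * (dt a b i (i + 1) * dt a b j (j + 1))
                  = dt a b i (j + 1) * dt a b (i + 1) j).
Proof.
move=> row; have [aN bN pos] := turn; have N0 : (0 < n + 3)%N by lia.
have d0 i : dt a b i (i + 1) != 0 by rewrite gt_eqF // pos //; lia.
pose d i j := dt a b i (i + 1) * dt a b j (j + 1).
pose e i j := dt a b i (j + 1) * dt a b (i + 1) j.
have dv i j : (d i j %| e i j)%Z.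
  have -> : i = j + (i - j) by ring.
  rewrite (@periodicE _ (n + 3) (fun k => d (j + k) j %| e (j + k) j)%Z); last first.
    move=> k; rewrite /d /e.
    have -> : j + (k + (n + 3)%N%:Z) = j + k + (n + 3)%N by ring.
    have -> : j + k + (n + 3)%N%:Z + 1 = j + k + 1 + (n + 3)%N%:Z by ring.
    by rewrite (dtNl _ _ aN bN) (dtNr _ _ aN bN) !(dtNl _ _ aN bN) opprK mulrNN.
  have [[|r] rN ->] := modz_nat (i - j) N0.
    by rewrite addr0 /d /e [dt a b (j + 1) j]dt_anti mulrN rpredN.
  by have := row (j + r.+1%:Z) j; rewrite /cross_rel /d /e => <-;
    [apply: dvdz_mull | lia].
exists (fun i j => (e i j %/ d i j)%Z); split=> i j; last by rewrite divzK.
move=> ij; have := row i j ij; rewrite /cross_rel -/(d i j) -/(e i j) => <-.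
by rewrite mulzK // /d mulf_neq0.
Qed.
End Propagation.

(** * A rational polygon realising one row of a Y-frieze *)

Section InitialPolygon.
Variables (n : nat) (B : yfrieze n).

Definition diag_ratio (k : nat) : rat :=
  (entry B (n%:Z + 2) k.+1%:Z)%:~R / (entry B (n%:Z + 2) k.+1%:Z + 1)%:~R.

(* Solves [0, oo, x_k, x_(k+1)] = B (n + 2) (k + 1), normalised by x_0 = 1; the
   zero entry B (n + 2) (n + 1) makes x_(n+1) = 0. *)
Definition diag_point (k : nat) : rat := \prod_(i < k) diag_ratio i.

(** Index 0 is infinity and index [n + 2] is [diag_point n.+1], which is 0. So edge [n + 2] closes
    the polygon from 0 to infinity. *)
Definition diag_vertex (k : nat) : vertex :=
  if k is l.+1 then Some (diag_point l) else None.

Definition diag_num := antiext (n + 3) (fun k => num (diag_vertex k)).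
Definition diag_den := antiext (n + 3) (fun k => den (diag_vertex k)).

Lemma diag_entry_gt0 k : (k < n)%N -> 0 < entry B (n%:Z + 2) k.+1%:Z.
Proof. by move=> kn; have [_ pos _] := yfunP B; apply: pos; lia. Qed.

Lemma diag_point_gt0 k : (k <= n)%N -> 0 < diag_point k.
Proof.
move=> kn; apply: prodr_gt0 => i _; have in' := leq_trans (ltn_ord i) kn.
have := diag_entry_gt0 in'.
by move=> e0; rewrite divr_gt0 // ltr0z //; lia.
Qed.

Lemma diag_point_last : diag_point n.+1 = 0.
Proof.
have [/(_ n.+1%:Z) [B0 _] _ _] := yfunP B.
rewrite /diag_point big_ord_recr /= /diag_ratio.
by rewrite (_ : n%:Z + 2 = n.+1%:Z + 1) ?B0 ?mul0r ?mulr0 //; lia.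
Qed.

Lemma diag_pointS k : (k <= n)%N ->
  diag_point k.+1 * (entry B (n%:Z + 2) k.+1%:Z + 1)%:~R
  = diag_point k * (entry B (n%:Z + 2) k.+1%:Z)%:~R.
Proof.
move=> kn; rewrite /diag_point big_ord_recr /= /diag_ratio mulrA divfK // intr_eq0.
have [kn'|nk] := ltnP k n; first by have := diag_entry_gt0 kn'; lia.
have [/(_ n.+1%:Z) [B0 _] _ _] := yfunP B.
have -> : k = n by lia.
by rewrite (_ : n%:Z + 2 = n.+1%:Z + 1) ?B0 //; lia.
Qed.

(** Each new factor has the form [e / (e + 1)] with [e] nonnegative, hence is below 1. *)
Lemma diag_point_decr k l : (k < l <= n.+1)%N -> diag_point l < diag_point k.
Proof.
elim: l => // l IH /andP[]; rewrite !ltnS => kl ln.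
have : diag_point l.+1 < diag_point l.
  rewrite /diag_point big_ord_recr /= -/(diag_point l) gtr_pMr ?diag_point_gt0 //.
  rewrite /diag_ratio; have [ln'|nl] := ltnP l n.
    have := diag_entry_gt0 ln' => e0.
    by rewrite ltr_pdivrMr ?mul1r ?ltr0z ?ltr_int; lia.
  have [/(_ n.+1%:Z) [B0 _] _ _] := yfunP B.
  have -> : l = n by lia.
  by rewrite (_ : n%:Z + 2 = n.+1%:Z + 1) ?B0 ?mul0r //; lia.
move: kl; rewrite leq_eqVlt => /orP[/eqP -> // | kl] h.
by apply: lt_trans h (IH _); rewrite kl ltnW.
Qed.

Lemma diag_anti : antiperiodic (n + 3) diag_num /\ antiperiodic (n + 3) diag_den.
Proof. by split; apply: antiext_antiperiodic; lia. Qed.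

Lemma diag_dt k l : (k < n + 3)%N -> (l < n + 3)%N ->
  dt diag_num diag_den k%:Z l%:Z = vdet (diag_vertex k) (diag_vertex l).
Proof. by move=> kN lN; rewrite /dt /diag_num /diag_den !antiextE. Qed.

Lemma diag_turns_once : turns_once (n + 3) diag_num diag_den.
Proof.
have [aN bN] := diag_anti; apply: turns_onceP => // [|k l kl]; first by lia.
rewrite diag_dt ?vdet_gt0; [|lia|lia].
case: k l kl => [|k] [|l] //= kl; apply: diag_point_decr; lia.
Qed.

Lemma diag_coprime i : coprimez (diag_num i) (diag_den i).
Proof.
have [aN bN] := diag_anti; have N0 : (0 < n + 3)%N by lia.
rewrite (@periodicE _ (n + 3) (fun i => coprimez (diag_num i) (diag_den i))).
  have [r rN ->] := modz_nat i N0; rewrite /diag_num /diag_den !antiextE //.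
  by case: (diag_vertex r) => [x|] //=; rewrite coprimezE coprime_num_den.
by move=> k; rewrite aN bN coprimezN coprimez_sym coprimezN coprimez_sym.
Qed.

(** Since edge [n + 2] joins 0 to infinity, its determinants with other vertices are numerators and
    denominators up to sign. The relation becomes [diag_pointS] with denominators cleared. *)
Lemma diag_cross_row : cross_row B diag_num diag_den (n%:Z + 2).
Proof.
have [aN bN] := diag_anti => j jn.
have [k kE] : exists k : nat, j = k%:Z by exists (absz j); lia.
have -> : n%:Z + 2 = n.+2%:Z by lia.
have e3 : n.+2%:Z + 1 = 0%:Z + (n + 3)%N%:Z by lia.
have e1 : k%:Z + 1 = k.+1%:Z by lia.
have vn : diag_vertex n.+2 = Some 0 by rewrite /= diag_point_last.
rewrite /cross_rel kE e3 (dtNr _ _ aN bN) (dtNl _ _ aN bN) e1 !diag_dt; try lia.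
rewrite vn /vdet /= !mul0r !mul1r sub0r subr0 mulrNN.
(* For [k = 0] the edge also ends at infinity, and both sides vanish by the boundary condition of
   the Y-frieze. *)
case: k kE e1 => [|k] kE e1 /=.
  have [/(_ 0) [_ B0] _ _] := yfunP B.
  by rewrite (_ : n.+2%:Z = 0 + n%:Z + 2) ?B0 ?mul0r ?mulr0 //; lia.
have kn : (k <= n)%N by lia.
have := diag_pointS kn; have -> : n.+2%:Z = n%:Z + 2 by lia.
move: (diag_point k) (diag_point k.+1) (entry B _ _) => x y e xy.
have {}xy : numq y * denq x * (e + 1) = numq x * denq y * e.
  apply: (@intr_inj rat); rewrite !intrM.
  have dx : (denq x)%:~R != 0 :> rat by rewrite intr_eq0 denq_neq0.
  have dy : (denq y)%:~R != 0 :> rat by rewrite intr_eq0 denq_neq0.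
  have nx : (numq x)%:~R = x * (denq x)%:~R by rewrite -{2}[x]divq_num_den divfK.
  have ny : (numq y)%:~R = y * (denq y)%:~R by rewrite -{2}[y]divq_num_den divfK.
  rewrite nx ny; transitivity (y * (e + 1)%:~R * ((denq x)%:~R * (denq y)%:~R)).
    by ring.
  by rewrite xy; ring.
rewrite mulrBr; apply/eqP; rewrite subr_eq; apply/eqP.
transitivity (numq x * denq y * e); first by ring.
by rewrite -xy; ring.
Qed.
End InitialPolygon.

(** * From a Y-frieze back to a Farey path *)

Lemma integral_polygon_exists n (B : yfrieze n) :
  exists a b C, integral_polygon (n + 3) C a b /\
    forall i j, 1 <= i - j <= n%:Z + 2 -> C i j = entry B i j.
Proof.
have turn := diag_turns_once B.
have [C [CB Ccr]] := cross_row_extend turn (cross_row_all turn (@diag_cross_row _ B)).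
exists (diag_num B), (diag_den B), C; split=> //.
by split=> //; apply: diag_coprime.
Qed.

(** Converse of [lift_turns_once]: positivity of the determinants gives both distinctness and the
    clockwise order. *)
Lemma path_of_dt N a b : (0 < N)%N -> turns_once N a b ->
    (forall i, dt a b i (i + 1) = 1) ->
  exists p : cpath N, biinfinite_lift p a b.
Proof.
move=> N0 [aN bN pos] d1.
pose f (i : nat) := fraction (a i) (b i).
have nz i : nonzero a b i by apply: (@dt_neq0l a b i (i + 1)); rewrite d1.
have fN : f N = f 0%N.
  rewrite /f -[N%:Z]add0r aN bN -[- a 0]mulN1r -[- b 0]mulN1r fractionMl //.
have sz : size (mkseq f N.+1) == N.+1 by rewrite size_mkseq.
have pf i : (i <= N)%N -> nth None (Tuple sz) i = f i by move=> iN; rewrite nth_mkseq.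
have Pp : is_sc_clockwise_path (Tuple sz).
  apply/and4P; split.
  - apply/forallP => i; have iN := ltn_ord i; rewrite !pf //; last exact: ltnW.
    (* The determinant 1 is an integer multiple of [vdet], which is therefore a unit, that is 1 or
       -1. *)
    have [k k0] := fraction_vdet (nz i) (nz i.+1%:Z).
    have := d1 i; rewrite /dt -PoszD addn1 => -> e.
    suff : vdet (f i) (f i.+1) \is a GRing.unit by rewrite qualifE.
    by apply/unitrP; exists k; rewrite [_ * k]mulrC -e.
  - by rewrite !pf // fN.
  - have take_f : take N (Tuple sz) = mkseq f N.
      by rewrite /= /mkseq -map_take take_iota (minn_idPl _).
    rewrite take_f; apply/(uniqP None) => i j; rewrite !inE size_mkseq => iN jN.
    rewrite !nth_mkseq //.
    wlog ij : i j iN jN / (i < j)%N => [W fij|].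
      case: (ltngtP i j) => // ij; first exact: W.
      by apply/esym/W.
    move=> fij; have [k _] := fraction_vdet (nz i) (nz j).
    rewrite -/(f i) -/(f j) fij -/(dt a b i j) => e.
    have : 0 < dt a b i j by apply: pos; lia.
    rewrite e (_ : vdet _ _ = 0) ?mulr0 //.
    by rewrite /vdet; ring.
  - apply/'forall_'forall_'forall_implyP => i j k /andP[ij jk].
    rewrite !pf ?clockwise_fraction //; try exact: ltnW.
    by rewrite !mulr_gt0 ?pos //; have := ltn_ord k; lia.
exists (exist _ (Tuple sz) Pp); split=> // [i iN|i].
  by rewrite /pvertex /= -/(f i) nth_mkseq.
by have := d1 (i - 1); rewrite subrK.
Qed.

Theorem theoremC (n : nat) :
  exists Phi : path_class (n + 3)%N -> yfrieze n,
    (forall (p : cpath (n + 3)%N) (a b : int -> int), biinfinite_lift p a b ->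
       forall i j : int, 1 <= i - j <= n%:Z + 2 ->
         (entry (Phi (class_of p)) i j)%:~R =
         cross_ratio (fraction (a i) (b i)) (fraction (a (i + 1)) (b (i + 1)))
                     (fraction (a j) (b j)) (fraction (a (j + 1)) (b (j + 1))))
    /\ (forall B : yfrieze n, exists c : path_class (n + 3)%N, Phi c = B).
Proof.
have N1 : (1 < n + 3)%N by lia.
have N0 := ltnW N1.
(* The Y-frieze is chosen from a representative; invariance of cross-ratios under SL2 then gives its
   entries for every path of the class. *)
pose Phi (c : path_class (n + 3)) := projT1 (cid (yfrieze_of_path (repr c))).
have PhiE (p : cpath (n + 3)) i j : 1 <= i - j <= n%:Z + 2 ->
    (entry (Phi (class_of p)) i j)%:~R = path_cross_ratio p i j.
  move=> ij; rewrite (projT2 (cid (yfrieze_of_path (repr (class_of p))))) //.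
  by apply: path_cross_ratio_sl2 => //; apply/eqmodP; rewrite reprK.
exists Phi; split=> [p a b lift i j ij|B].
  by rewrite PhiE // /path_cross_ratio -!(lift_fraction _ N0 lift).
have [a0 [b0 [C [poly0 CB]]]] := integral_polygon_exists B.
have [a [b [[turn _ Ccr] d1]]] := integral_polygon_unimodular N1 poly0.
have [p lift] := path_of_dt N0 turn d1.
exists (class_of p).
(* With all consecutive determinants 1, the relation [Ccr] equates the cross-ratios with the values
   of [C], which are the entries of [B] on this range. *)
have entryE i j : 1 <= i - j <= n%:Z + 2 ->
    entry (Phi (class_of p)) i j = entry B i j.
  move=> ij; apply: (@intr_inj rat); rewrite PhiE // (path_cross_ratioE _ _ N0 lift).
  by rewrite -Ccr !d1 !mulr1 CB.
case: (Phi _) B entryE {poly0 CB} => [f Pf] [g Pg] entryE.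
have fg : f = g.
  apply: funext => -[[i j] ij]; have := entryE i j ij.
  by rewrite /entry !insubT.
by move: Pf Pg {entryE}; rewrite fg => Pf Pg; congr YFrieze; apply: Prop_irrelevance.
Qed.
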